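(* Let $S=S(\lambda_1,\ldots,\lambda_d)$ be a spider with $n=1+\lambda_1+\cdots+\lambda_d$ vertices and $\lambda_1\ge\cdots\ge\lambda_d$. Fix an index $i$ with $2\le i<d$ and a positive integer $m$. Let $a=\lceil(\lambda_i+1)/m\rceil$, write $n=qa+r$ with $0\le r<a$ (so $q=\lfloor n/a\rfloor$), write $r=qd'+r'$ with $0\le r'<q$, and let $t=\lambda_{i+1}+\cdots+\lambda_d$. If $t>2m-1$, $a>\lambda_{i+1}$, and $q>\frac{m(a-1)}{t-2m+1}$, then $S$ has no connected partition of type $((a+d'+1)^{r'},(a+d')^{q-r'})$, and consequently $S$ is not $e$-positive.
   Context: A spider $S(\lambda_1,\ldots,\lambda_d)$, for positive integers $\lambda_1\ge\cdots\ge\lambda_d$, is the tree consisting of a vertex $v$ (the center) together with $d$ vertex-disjoint paths (legs) having $\lambda_1,\ldots,\lambda_d$ vertices respectively, where $v$ is joined by an edge to one endpoint of each leg; it has $1+\lambda_1+\cdots+\lambda_d$ vertices. A connected partition of a graph $G=(V,E)$ is a partition of $V$ into blocks each inducing a connected subgraph; its type is the integer partition of $|V|$ formed by the block sizes. $(b^{x},c^{y})$ denotes the partition with $x$ parts equal to $b$ and $y$ parts equal to $c$. The chromatic symmetric function of a graph $G$ is $X_G=\sum_\kappa \prod_{v} x_{\kappa(v)}$ over proper colorings $\kappa$; $G$ is $e$-positive if $X_G$ is a nonnegative linear combination of elementary symmetric functions $e_\lambda$. *)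

(* Defs.v *)
From HB Require Import structures.
From mathcomp Require Import all_boot all_order all_algebra.
From mathcomp Require Import mpoly.
Import Order.TTheory GRing.Theory Num.Theory.

(* Simple graphs: a relation e on a finite type T (assumed symmetric,  *)
(* irreflexive by construction where used).                            *)

Definition induced_connected {T : finType} (e : rel T) (B : {set T}) : bool :=
  [forall x in B, forall y in B,
     connect (fun u v => [&& e u v, u \in B & v \in B]) x y].

Definition connected_partition {T : finType} (e : rel T) (P : {set {set T}}) : bool :=
  partition P [set: T] && [forall B in P, induced_connected e B].

Definition has_type {T : finType} (P : {set {set T}}) (mu : seq nat) : bool :=
  perm_eq [seq #|B| | B : {set T} in P] mu.

(* Spiders.  lam = [:: lam_1; ...; lam_d].  Vertex set 'I_(1+sum lam): *)
(* 0 is the center; leg j (0-based) occupies the consecutive vertices  *)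
(* 1 + lam_1+...+lam_j, ..., lam_1+...+lam_(j+1), its first vertex     *)
(* being adjacent to the center.                                       *)
Definition leg_start (lam : seq nat) (v : nat) : bool :=
  has (fun j => v == (sumn (take j lam)).+1) (iota 0 (size lam)).

Definition spider_adj (lam : seq nat) (u v : nat) : bool :=
  ((u == 0) && leg_start lam v)
  || [&& 0 < u, v == u.+1 & ~~ leg_start lam v].

Definition spider_vertex (lam : seq nat) := 'I_(sumn lam).+1.

Definition spider (lam : seq nat) : rel (spider_vertex lam) :=
  fun u v => spider_adj lam u v || spider_adj lam v u.

(* Chromatic symmetric function, in N = |V| variables x_0..x_(N-1)    *)
(* (this loses no information for e-positivity).        *)
Definition chromatic_sym {T : finType} (e : rel T) : {mpoly rat[#|T|]} :=
  (\sum_(k : {ffun T -> 'I_#|T|} | [forall u, forall v, e u v ==> (k u != k v)])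
     \prod_(v : T) 'X_(k v))%R.

Definition elem_sym (N : nat) (mu : seq nat) : {mpoly rat[N]} :=
  (\prod_(k <- mu) mesym N rat k)%R.

Definition is_int_partition (mu : seq nat) : bool :=
  sorted geq mu && all (fun k => 0 < k) mu.

Definition e_positive {T : finType} (e : rel T) : Prop :=
  exists s : seq (seq nat * rat),
    all (fun p => is_int_partition p.1 && (0 <= p.2)%R) s /\
    chromatic_sym e = (\sum_(p <- s) p.2 *: elem_sym #|T| p.1)%R.

(* Main.v *)
(* Wolfgang's argument for trees.  Expanding the product of the 1 - [k v = k (parent v)]
   over the edges writes X as the sum over edge subsets S of (-1)^|S| times the product
   of the power sums p_|C| over the components C of the forest S.  The substitution
   p_k = (-1)^(k-1) w_k turns this into a sum, without signs, of products of the w_|C|,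
   and by Newton's identities it turns e_k into the h_k with k h_k = sum_j w_j h_(k-j),
   which have nonnegative coefficients in the w_j.  Comparing the coefficients of w_n
   shows that e_n has a positive coefficient in an e-positive X; since every monomial of
   weight n occurs in h_n, every integer partition of n is then the type of a connected
   partition.

   For the spider, a block that avoids the center lies inside one leg.  Hence the
   block of the center contains the legs i+1, ..., d, which are too short for a block,
   and if k blocks lie inside leg i, then it contains all but at most k(b+1) vertices of
   that leg, where b and b+1 are the block sizes; this exceeds b+1 vertices. *)
Require Import Defs.
From HB Require Import structures.
From mathcomp Require Import all_boot all_order all_algebra.
From mathcomp Require Import perm mpoly.
From mathcomp Require Import zify ring.
Import Order.TTheory GRing.Theory Num.Theory.

(** * Colorings of a recursive tree *)

(** Such a coloring is determined by its free values at the fixed points of [g], and the color of a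
    fixed point [r] is used on the whole fiber of [g] over [r]; distributivity then factors the
    sum. *)
Lemma sum_idempotent_coloring (R : comNzRingType) (T I : finType) (i0 : I)
    (g : T -> T) (x : I -> R) : (forall v, g (g v) = g v) ->
  (\sum_(k : {ffun T -> I} | [forall v, k v == k (g v)]) \prod_v x (k v)
   = \prod_(r | g r == r) \sum_i x i ^+ #|[set v | g v == r]|)%R.
Proof.
move=> gg; rewrite (big_distr_big i0) /=.
(* [big_distr_big] sums over functions equal to [i0] off the fixed points, so [restr] resets all
   other vertices to [i0]. *)
pose restr (k : {ffun T -> I}) := [ffun v => if g v == v then k v else i0].
pose ext (k : {ffun T -> I}) := [ffun v => k (g v)].
rewrite (reindex_onto ext restr) /=; last first.
  by move=> k /forallP kg; apply/ffunP => v; rewrite !ffunE gg eqxx -(eqP (kg v)).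
apply: eq_big => [k | k _].
  apply/andP/pffun_onP => [[_ /eqP <-] | [/subsetP k_supp _]].
    split=> //; apply/subsetP => v; rewrite !inE !ffunE.
    by rewrite unfold_in; case: ifP => //; rewrite eqxx.
  split; first by apply/forallP => v; rewrite !ffunE gg.
  apply/eqP/ffunP => v; rewrite !ffunE; case: (eqVneq (g v) v) => [-> // | gv].
  apply/esym/eqP; apply: contraNT gv => kv; apply: k_supp.
  by rewrite unfold_in.
rewrite (partition_big g (fun r => g r == r)) /= => [|v _]; last by rewrite gg.
apply: eq_bigr => r _; under eq_bigr => v /eqP gv do rewrite ffunE gv.
by rewrite prodr_const; congr (_ ^+ _)%R; apply: eq_card => v; rewrite inE.
Qed.

Section RecursiveTree.
Variables (N : nat) (f : 'I_N -> 'I_N) (D : {set 'I_N}).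
Hypothesis f_lt : forall v, v \in D -> f v < v.
Implicit Types (S : {set 'I_N}) (v r : 'I_N).

(** An edge is named by its child, so [S] is an edge subset and [climb S v] is the root of the
    component of [v]. Labels drop at each move, so [N] rounds suffice. *)
Definition climb S v := iter N (fun u => if u \in S then f u else u) v.

Lemma iter_climb_id S v k : v \notin S ->
  iter k (fun u => if u \in S then f u else u) v = v.
Proof. by move=> vS; elim: k => //= k ->; rewrite (negbTE vS). Qed.

Lemma climb_notin S v : S \subset D -> climb S v \notin S.
Proof.
move=> /subsetP SD.
(* Either the climb has stopped, or it has descended by at least [k]; the latter is impossible for
   [k = N]. *)
suff /(_ N): forall k, let u := iter k (fun u => if u \in S then f u else u) v in
    (u \notin S) || (u + k <= v).
  by case/orP=> //; have := ltn_ord v; lia.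
elim=> [|k] /=; first by rewrite addn0 leqnn orbT.
set u := iter k _ v => /orP[uS | uv]; first by rewrite (negbTE uS) uS.
case: ifP => [uS | ->] //; apply/orP; right.
by have := f_lt _ (SD _ uS); lia.
Qed.

Lemma climb_id S v : v \notin S -> climb S v = v.
Proof. exact: iter_climb_id. Qed.

Lemma climb_fixed S v : S \subset D -> (climb S v == v) = (v \notin S).
Proof.
move=> SD; apply/eqP/idP => [<- | /climb_id //]; exact: climb_notin.
Qed.

Lemma climb_climb S v : S \subset D -> climb S (climb S v) = climb S v.
Proof. by move=> SD; apply/climb_id/climb_notin. Qed.

Lemma climb_parent S v : S \subset D -> v \in S -> climb S (f v) = climb S v.
Proof.
move=> SD vS; rewrite /climb.
have -> : f v = (fun u => if u \in S then f u else u) v by rewrite /= vS.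
by rewrite -iterSr /=; case: ifP (climb_notin S v SD) => // ->.
Qed.

(** For [r] outside [S], this is the component with root [r] of the forest with edge set [S]; hence
    components are indexed by [~: S]. *)
Definition branch S r : {set 'I_N} := [set v | climb S v == r].

Lemma branch_gt0 S r : r \notin S -> 0 < #|branch S r|.
Proof.
by move=> rS; apply/card_gt0P; exists r; rewrite inE climb_id.
Qed.

Lemma sum_branch S : S \subset D -> \sum_(r in ~: S) #|branch S r| = N.
Proof.
move=> SD; rewrite -[RHS](card_ord N) -[RHS]sum1_card.
rewrite [RHS](partition_big (climb S) (mem (~: S))) /= => [|v _]; last first.
  by rewrite inE climb_notin.
by apply: eq_bigr => r _; rewrite -sum1_card; apply: eq_bigl => v; rewrite inE.
Qed.

Lemma branch_inj S : {in ~: S &, injective (branch S)}.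
Proof.
move=> r r'; rewrite !inE => rS r'S /setP /(_ r).
by rewrite !inE climb_id // eqxx => /esym/eqP.
Qed.

Lemma branch_partition S : S \subset D ->
  partition [set branch S r | r in ~: S] [set: 'I_N].
Proof.
move=> SD; apply/and3P; split.
- rewrite eqEsubset subsetT; apply/subsetP => v _; apply/bigcupP.
  exists (branch S (climb S v)); last by rewrite inE.
  by apply: imset_f; rewrite inE climb_notin.
- apply/trivIsetP => _ _ /imsetP[r rS ->] /imsetP[r' r'S ->] neq.
  rewrite -setI_eq0; apply/eqP/setP => v; rewrite !inE.
  by apply/negP => /andP[/eqP-> /eqP rr']; rewrite rr' eqxx in neq.
apply/imsetP => -[r]; rewrite inE => /branch_gt0 + r0.
by rewrite -r0 cards0.
Qed.

Lemma branch_connected (e : rel 'I_N) S r :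
  S \subset D -> ssrbool.symmetric e -> (forall v, v \in D -> e v (f v)) ->
  induced_connected e (branch S r).
Proof.
move=> SD e_sym e_f; set e' := fun u v => [&& e u v, u \in branch S r & v \in branch S r].
have conn_sym : connect_sym e'.
  by apply: sym_connect_sym => u v; rewrite /e' e_sym [(u \in _) && _]andbC.
have to_root v : v \in branch S r -> connect e' v r.
  rewrite inE => /eqP vr; rewrite -[X in connect _ _ X]vr.
  suff: forall k, let u := iter k (fun u => if u \in S then f u else u) v in
      connect e' v u /\ climb S u = climb S v.
    by move/(_ N) => [].
  elim=> [|k] /=; first by split=> //; apply: connect0.
  set u := iter k _ v => -[vu uv]; case: ifP => // uS.
  split; last by rewrite climb_parent.
  apply: connect_trans vu _; apply: connect1.
  by rewrite /e' !inE climb_parent // uv vr eqxx e_f //; apply: (subsetP SD).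
apply/forall_inP => u ur; apply/forall_inP => v vr.
by apply: connect_trans (to_root _ ur) _; rewrite conn_sym; apply: to_root.
Qed.

Lemma climb_constP (I : eqType) (k : 'I_N -> I) S : S \subset D ->
  [forall v in S, k v == k (f v)] = [forall v, k v == k (climb S v)].
Proof.
move=> SD; apply/forall_inP/forallP => [kS v | kS v vS]; last first.
  by rewrite (eqP (kS v)) -climb_parent // -(eqP (kS (f v))).
suff /(_ N) E: forall n, k (iter n (fun u => if u \in S then f u else u) v) = k v.
  by rewrite /climb E.
by elim=> //= n <-; case: ifP => // /kS /eqP.
Qed.

(** Inclusion-exclusion over the monochromatic edges: the colorings constant along the edges of [S]
    are those constant on its components, and they are summed by [sum_idempotent_coloring]. *)
Lemma tree_coloring_sum (R : comNzRingType) (I : finType) (i0 : I) (x : I -> R) :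
  (\sum_(k : {ffun 'I_N -> I} | [forall v in D, k v != k (f v)]) \prod_v x (k v)
   = \sum_(S : {set 'I_N} | S \subset D)
       (-1) ^+ #|S| * \prod_(r in ~: S) \sum_i x i ^+ #|branch S r|)%R.
Proof.
pose mono (k : {ffun 'I_N -> I}) v := k v == k (f v).
transitivity (\sum_(k : {ffun 'I_N -> I}) \sum_(S : {set 'I_N} | S \subset D)
    ((-1) ^+ #|S| *+ [forall v in S, mono k v] * \prod_v x (k v)))%R.
  rewrite big_mkcond; apply: eq_bigr => k _; rewrite -mulr_suml.
  transitivity ((\prod_v ((if v \in D then - (mono k v)%:R else 0) + 1)) *
                \prod_v x (k v))%R.
    case: ifP => [/forall_inP proper | /forall_inPn[v vD]].
      rewrite [X in (X * _)%R]big1 ?mul1r // => v _; case: ifP => [vD|]; last by rewrite add0r.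
      by rewrite /mono (negbTE (proper v vD)) oppr0 add0r.
    rewrite negbK => kv.
    by rewrite [X in (X * _)%R](bigD1 v) //= vD /mono kv addNr !mul0r.
  congr (_ * _)%R; rewrite bigA_distr [RHS]big_mkcond; apply: eq_bigr => S _.
  rewrite -big_mkcond /=; case: ifP => [/subsetP SD | /subsetPn[v vS vD]]; last first.
    by rewrite (bigD1 v) //= (negbTE vD) mul0r.
  transitivity (\prod_(v in S) - (mono k v)%:R : R)%R.
    by apply: eq_bigr => v /SD ->.
  rewrite prodrN -mulr_natr; congr (_ * _)%R; case: forall_inP => [kS | /forall_inP].
    by rewrite big1 // => v vS; rewrite kS.
  by move/forall_inPn => [v vS kv]; rewrite (bigD1 v) //= (negbTE kv) mul0r.
rewrite exchange_big /=; apply: eq_bigr => S SD.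
have -> : (\prod_(r in ~: S) \sum_i x i ^+ #|branch S r|)%R
    = (\prod_(r | climb S r == r) \sum_i x i ^+ #|[set v | climb S v == r]|)%R.
  by apply: eq_bigl => r; rewrite climb_fixed // inE.
rewrite -(sum_idempotent_coloring _ _ _ i0) => [|v]; last exact: climb_climb.
rewrite mulr_sumr [RHS]big_mkcond /=; apply: eq_bigr => k _.
rewrite climb_constP //; case: ifP => _; by rewrite ?mulr1n ?mulr0n ?mul0r.
Qed.

End RecursiveTree.

(** * Newton's identities and specializations *)

Section Newton.
Local Open Scope ring_scope.

Lemma deriv_prod (R : comNzRingType) (I : eqType) (r : seq I) (F : I -> {poly R}) :
  uniq r ->
  (\prod_(i <- r) F i)^`() = \sum_(i <- r) (F i)^`() * \prod_(j <- r | j != i) F j.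
Proof.
elim: r => [|i r IHr] /=; first by rewrite !big_nil derivC.
case/andP=> ir /IHr {}IHr; rewrite !big_cons derivM IHr eqxx /=; congr (_ * _ + _).
  rewrite big_seq [RHS]big_seq_cond; apply: eq_bigl => j.
  by case jr: (j \in r) => //=; apply/esym; apply: contraNneq ir => <-.
rewrite mulr_sumr !big_seq; apply: eq_bigr => j jr; rewrite big_cons.
by rewrite mulrCA; case: eqP ir => // ->; rewrite jr.
Qed.

Lemma coef_prod_linear (R : comNzRingType) (I : finType) (x : I -> R) (k : nat) :
  (\prod_i (1 + x i *: 'X : {poly R}))`_k
  = \sum_(h : {set I} | #|h| == k) \prod_(i in h) x i.
Proof.
under eq_bigr do rewrite addrC.
rewrite bigA_distr coef_sum [RHS]big_mkcond; apply: eq_bigr => h _.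
rewrite -big_mkcond scaler_prod prodr_const coefZ coefXn /= eq_sym.
by case: eqP => _; rewrite ?mulr1 ?mulr0.
Qed.

(** The left side is a coefficient of the derivative of [P], the product of the [1 + x i *: 'X]. The
    identity holds for each [i] separately: it expands [Pwo i], which is [P] divided by
    [1 + x i *: 'X], as a geometric series. *)
Lemma newton_identity (R : comNzRingType) (I : finType) (x : I -> R) (k : nat) :
  let e k := \sum_(h : {set I} | #|h| == k) \prod_(i in h) x i in
  e k.+1 *+ k.+1
  = \sum_(j < k.+1) (-1) ^+ j * (\sum_i x i ^+ j.+1) * e (k - j)%N.
Proof.
pose P : {poly R} := \prod_i (1 + x i *: 'X).
pose Pwo i : {poly R} := \prod_(j | j != i) (1 + x j *: 'X).
move=> /=; rewrite -coef_prod_linear -/P -coef_deriv.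
under [RHS]eq_bigr do rewrite -coef_prod_linear -/P.
rewrite deriv_prod ?index_enum_uniq // coef_sum.
under [LHS]eq_bigr do rewrite derivD -[1]/(1%:P) derivC add0r derivZ derivX -scalerAl mul1r coefZ -/(Pwo _).
under [RHS]eq_bigr do rewrite mulr_sumr mulr_suml.
rewrite exchange_big /=; apply: eq_bigr => i _.
have PE m : P`_m.+1 = (Pwo i)`_m.+1 + x i * (Pwo i)`_m.
  rewrite /P (bigD1 i) //= -/(Pwo i) mulrDl mul1r coefD -scalerAl coefZ.
  by rewrite coefXM.
elim: k => [|k IHk].
  rewrite big_ord1 expr0 mul1r expr1 /P (bigD1 i) //= -/(Pwo i).
  by rewrite mulrDl mul1r coefD -scalerAl coefZ coefXM mulr0 addr0.
rewrite big_ord_recl expr0 mul1r expr1 subn0 PE mulrDr mulrA -[LHS]addr0 -addrA.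
congr (_ + _); under eq_bigr do rewrite subSS !exprS mulrA !mulN1r.
apply/eqP; rewrite eq_sym addrC -subr_eq0 subr0 -mulrA IHk mulr_sumr -big_split big1 //= => j _.
by rewrite exprS; ring.
Qed.

Lemma psum_symmetric (N : nat) (R : nzRingType) (k : nat) :
  \sum_i ('X_i : {mpoly R[N]}) ^+ k \is symmetric.
Proof.
apply/issymP => s; rewrite rmorph_sum /=.
rewrite [RHS](reindex_inj (@perm_inj _ s)); apply: eq_bigr => i _.
rewrite rmorphXn /= msymX; congr ('X_[_] ^+ _); apply/mnmP => j.
by rewrite !mnmE -(inj_eq (@perm_inj _ s)) permKV.
Qed.

End Newton.

Section Specialization.
Local Open Scope ring_scope.

(** The elementary symmetric polynomials are algebraically independent, so their images may be
    prescribed; Newton's identities then force the images of the power sums. The cutoff at [N]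
    reflects that [mesym N rat k] vanishes for [k > N]. *)
Lemma newton_specialization (N : nat) (h w : nat -> {poly rat}) :
  h 0%N = 1 ->
  (forall k, h k.+1 *+ k.+1 = \sum_(j < k.+1) w j.+1 * h (k - j)%N) ->
  let S := [tuple mesym N rat i.+1 | i < N] in
  exists E P : nat -> {mpoly rat[N]}, exists phi : {rmorphism {mpoly rat[N]} -> {poly rat}},
  [/\ forall k, E k \mPo S = mesym N rat k,
      forall k, P k \mPo S = \sum_i 'X_i ^+ k,
      forall k, phi (E k) = if (k <= N)%N then h k else 0,
      forall k, (k < N)%N -> phi (P k.+1) = (-1) ^+ k * w k.+1
    & forall c p, phi (c *: p) = c *: phi p].
Proof.
move=> h0 hS S; pose h' k := if (k <= N)%N then h k else 0.
pose E k := sval (sym_fundamental (mesym_sym N rat k)).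
pose P k := sval (sym_fundamental (psum_symmetric N rat k)).
have ES k : E k \mPo S = mesym N rat k by rewrite /E; case: sym_fundamental => t [].
have PS k : P k \mPo S = \sum_i 'X_i ^+ k by rewrite /P; case: sym_fundamental => t [].
have [phi phiE phiZ] : exists2 phi : {rmorphism {mpoly rat[N]} -> {poly rat}},
    forall k, phi (E k) = h' k & forall c p, phi (c *: p) = c *: phi p.
  (* Variable number [i] stands for the elementary symmetric polynomial of degree [i.+1], hence the
     shift. *)
  exists (mmap (polyC : {rmorphism rat -> {poly rat}}) (fun i : 'I_N => h i.+1));
    last by move=> c p; rewrite /= mmapZ mul_polyC.
  rewrite /h' => -[|k].
    rewrite (_ : E 0%N = 1) ?rmorph1 ?h0 //; apply: msym_fundamental_un.
    by rewrite ES mesym0E rmorph1.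
  case: ltnP => [kN | Nk]; last first.
    rewrite (_ : E _ = 0) ?rmorph0 //; apply: msym_fundamental_un.
    by rewrite ES rmorph0 mesym_geqnE.
  rewrite (_ : E _ = 'X_(Ordinal kN)) /= ?mmapX ?mmap1U //.
  by apply: msym_fundamental_un; rewrite ES comp_mpolyXU -tnth_nth tnth_mktuple.
exists E, P, phi; split=> // k kN.
have newton m : E m.+1 *+ m.+1 = \sum_(j < m.+1) (-1) ^+ j * P j.+1 * E (m - j)%N.
  apply: msym_fundamental_un; rewrite rmorphMn /= ES rmorph_sum /=.
  transitivity (\sum_(j < m.+1)
      (-1) ^+ j * (\sum_i 'X_i ^+ j.+1) * mesym N rat (m - j)%N).
    exact: newton_identity.
  by apply: eq_bigr => j _; rewrite !rmorphM !rmorphXn rmorphN1 /= ES PS.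
elim/ltn_ind: k kN => k IHk kN.
have := congr1 phi (newton k); rewrite rmorphMn rmorph_sum phiE /h' kN hS.
rewrite !big_ord_recr /= !rmorphM rmorphXn rmorphN1 subnn phiE /h' h0 !mulr1.
set lhs := \sum_(i < k) _; set rhs := \sum_(i < k) _.
(* By induction the two signs [(-1) ^+ j] cancel, so the sums below the top index agree and the top
   terms can be compared. *)
have -> : rhs = lhs.
  apply: eq_bigr => j _; rewrite !rmorphM rmorphXn rmorphN1 phiE /h'.
  have jN : (j < N)%N := ltn_trans (ltn_ord j) kN.
  rewrite (leq_trans (leq_subr _ _) (ltnW kN)) IHk // mulrA -expr2.
  by rewrite -exprM mulnC exprM sqrrN expr1n expr1n mul1r.
by move/addrI => ->; rewrite mulrA -expr2 -exprM mulnC exprM sqrrN expr1n expr1n mul1r.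
Qed.

(** Over the rationals the recursion can be solved for [h k.+1]. It needs all earlier values, so the
    list of values is extended one entry at a time. *)
Lemma exists_complete_sequence (w : nat -> {poly rat}) : exists h : nat -> {poly rat},
  h 0%N = 1 /\ forall k, h k.+1 *+ k.+1 = \sum_(j < k.+1) w j.+1 * h (k - j)%N.
Proof.
pose step (s : seq {poly rat}) :=
  rcons s ((size s)%:R^-1 *: \sum_(j < size s) w j.+1 * s`_((size s).-1 - j)).
pose hs k := iter k step [:: 1].
have size_hs k : size (hs k) = k.+1 by elim: k => //= k IHk; rewrite size_rcons IHk.
have nth_hs k m : (m <= k)%N -> (hs k)`_m = (hs m)`_m.
  elim: k => [|k IHk]; first by case: m.
  rewrite leq_eqVlt ltnS => /orP[/eqP -> // | mk].
  by rewrite /= nth_rcons size_hs ltnS mk IHk.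
exists (fun k => (hs k)`_k); split=> // k.
rewrite /= /step nth_rcons size_hs ltnn eqxx -scaler_nat scalerA divff ?pnatr_eq0 //.
rewrite scale1r; apply: eq_bigr => j _; rewrite nth_hs //; exact: leq_subr.
Qed.
End Specialization.

(** * Specialization of the chromatic symmetric function of a tree *)

Section TreeSpecialization.
Variables (N : nat) (f : 'I_N -> 'I_N) (D : {set 'I_N}) (e : rel 'I_N).
Hypothesis f_lt : forall v, v \in D -> f v < v.
Hypothesis eE : forall u v, e u v = (u \in D) && (v == f u) || (v \in D) && (u == f v).
Hypothesis N_gt0 : 0 < N.

Local Open Scope ring_scope.

Lemma chromatic_tree : chromatic_sym e =
  \sum_(S : {set 'I_N} | S \subset D)
    (-1) ^+ #|S| * \prod_(r in ~: S)
       \sum_i ('X_i : {mpoly rat[#|{: 'I_N}|]}) ^+ #|branch N f S r|.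
Proof.
have N_gt0' : (0 < #|'I_N|)%N by rewrite card_ord.
rewrite -(tree_coloring_sum N f D f_lt _ _ (Ordinal N_gt0')) /chromatic_sym.
apply: eq_bigl => k; apply/forallP/forall_inP => [proper v vD | proper u].
  by have /forallP/(_ (f v)) := proper v; rewrite eE vD eqxx.
apply/forallP => v; apply/implyP; rewrite eE => /orP[] /andP[+ /eqP ->].
  exact: proper.
by rewrite eq_sym; apply: proper.
Qed.

(** The sizes of the [N - #|S|] components add up to [N], so the exponents in the product add up to
    [#|S|] and the total exponent is even. *)
Lemma sign_branches (S : {set 'I_N}) : S \subset D ->
  (-1) ^+ #|S| * \prod_(r in ~: S) (-1) ^+ #|branch N f S r|.-1 = 1 :> {poly rat}.
Proof.
move=> SD; rewrite prodrXr -exprD -signr_odd (_ : odd _ = false) //.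
have : (\sum_(r in ~: S) #|branch N f S r|.-1 + #|~: S| = N)%N.
  rewrite -sum1_card -big_split /= -[RHS](sum_branch _ f D f_lt S SD).
  by apply: eq_bigr => r; rewrite inE => /branch_gt0 rS; rewrite addn1 prednK.
have := cardsC S; rewrite card_ord; lia.
Qed.

Lemma e_expansion_specialization (s : seq (seq nat * rat)) (h w : nat -> {poly rat}) :
  chromatic_sym e = \sum_(p <- s) p.2 *: elem_sym #|{: 'I_N}| p.1 ->
  h 0%N = 1 ->
  (forall k, h k.+1 *+ k.+1 = \sum_(j < k.+1) w j.+1 * h (k - j)%N) ->
  \sum_(S : {set 'I_N} | S \subset D) \prod_(r in ~: S) w #|branch N f S r|
  = \sum_(p <- s) p.2 *: \prod_(k <- p.1) (if (k <= N)%N then h k else 0).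
Proof.
move=> + h0 hS; rewrite chromatic_tree => X_e.
have [E [P [phi [ES PS phiE phiP phiZ]]]] := newton_specialization #|{: 'I_N}| h w h0 hS.
transitivity (phi (\sum_(S : {set 'I_N} | S \subset D)
    (-1) ^+ #|S| * \prod_(r in ~: S) P #|branch N f S r|)).
  rewrite rmorph_sum; apply: eq_bigr => S SD.
  rewrite rmorphM rmorphXn rmorphN1 rmorph_prod.
  under [in RHS]eq_bigr => r rS.
    have b_gt0 : (0 < #|branch N f S r|)%N by apply: branch_gt0; rewrite inE in rS.
    rewrite -(prednK b_gt0) phiP; last by rewrite prednK // max_card.
    rewrite prednK //; over.
  by rewrite big_split /= mulrA sign_branches // mul1r.
transitivity (phi (\sum_(p <- s) p.2 *: \prod_(k <- p.1) E k)).
  (* By algebraic independence it suffices to compare the two sides after substituting the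
     elementary symmetric polynomials, where they are two expressions for the chromatic symmetric
     function. *)
  congr (phi _); apply: msym_fundamental_un.
  rewrite !rmorph_sum /=; transitivity (\sum_(p <- s) p.2 *: elem_sym #|{: 'I_N}| p.1).
    rewrite -X_e; apply: eq_bigr => S _.
    rewrite rmorphM rmorphXn rmorphN1 rmorph_prod; congr (_ * _).
    by apply: eq_bigr => r _; rewrite /= PS.
  apply: eq_bigr => p _; rewrite comp_mpolyZ rmorph_prod; congr (_ *: _).
  by apply: eq_bigr => k _; rewrite /= ES.
rewrite rmorph_sum; apply: eq_bigr => p _; rewrite phiZ rmorph_prod; congr (_ *: _).
by apply: eq_bigr => k _; rewrite phiE card_ord.
Qed.

End TreeSpecialization.

(** * Coefficients of the complete sequences *)

Section NonnegCoefficients.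
Local Open Scope ring_scope.

Definition nneg_coefs (p : {poly rat}) := forall i, 0 <= p`_i.

Lemma nneg_coefsM p q : nneg_coefs p -> nneg_coefs q -> nneg_coefs (p * q).
Proof. by move=> p0 q0 i; rewrite coefM sumr_ge0 // => j _; rewrite mulr_ge0. Qed.

Lemma nneg_coefs_sum (I : finType) (F : I -> {poly rat}) :
  (forall i, nneg_coefs (F i)) -> nneg_coefs (\sum_i F i).
Proof. by move=> F0 i; rewrite coef_sum sumr_ge0 // => j _; apply: F0. Qed.

Lemma nneg_coefs_prod (I : Type) (r : seq I) (A : pred I) (F : I -> {poly rat}) :
  (forall i, nneg_coefs (F i)) -> nneg_coefs (\prod_(i <- r | A i) F i).
Proof.
move=> F0; elim/big_rec: _ => [i | i p _ p0]; last exact: nneg_coefsM.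
by rewrite coef1 ler0n.
Qed.

Lemma nneg_coefsX : nneg_coefs 'X.
Proof. by move=> i; rewrite coefX ler0n. Qed.

Lemma nneg_coefs0 : nneg_coefs 0.
Proof. by move=> i; rewrite coef0. Qed.

Section Complete.
Variables (h w : nat -> {poly rat}).
Hypothesis (h0 : h 0%N = 1).
Hypothesis hS : forall k, h k.+1 *+ k.+1 = \sum_(j < k.+1) w j.+1 * h (k - j)%N.
Hypothesis w_ge0 : forall k, nneg_coefs (w k).

Lemma nneg_coefs_complete k : nneg_coefs (h k).
Proof.
elim/ltn_ind: k => -[|k] IHk i; first by rewrite h0 coef1 ler0n.
rewrite -(pmulrn_lge0 _ (ltn0Sn k)) -coefMn hS; apply: nneg_coefs_sum => j.
by apply: nneg_coefsM => //; apply: IHk; rewrite ltnS leq_subr.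
Qed.

Lemma complete_coef_gt0 k j l : (0 < j <= k)%N -> w j = 'X ->
  0 < (h (k - j)%N)`_l -> 0 < (h k)`_l.+1.
Proof.
case: k j => [|k] [|j] //= jk wj; rewrite subSS => hl.
rewrite -(pmulrn_lgt0 _ (ltn0Sn k)) -coefMn hS (bigD1 (Ordinal jk)) //= wj coefD coefXM /=.
rewrite ltr_wpDr // coef_sum sumr_ge0 // => i _.
by apply: nneg_coefsM => //; apply: nneg_coefs_complete.
Qed.

(** The power of ['X] counts parts. Removing one part of size [b] or [b.+1] lowers both the weight
    and this power, and the recursion for [h] has no negative terms to cancel against. *)
Lemma complete_coef_two_sizes b x y : (0 < b)%N -> w b = 'X -> w b.+1 = 'X ->
  0 < (h (x * b + y * b.+1)%N)`_(x + y).
Proof.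
move=> b_gt0 wb wb1; elim: x => [|x IHx].
  elim: y => [|y IHy]; first by rewrite h0 coef1.
  apply: (@complete_coef_gt0 _ b.+1) => //; first by rewrite add0n mulSn leq_addr.
  by rewrite add0n mulSn addKn.
apply: (@complete_coef_gt0 _ b) => //; first by rewrite mulSn b_gt0 -addnA leq_addr.
by rewrite mulSn -addnA addKn.
Qed.

End Complete.

(** Here [h k] vanishes for [0 < k < N] and [h N] is ['X] divided by [N], so two or more parts give
    a multiple of ['X^2] and the empty partition gives 1. *)
Lemma single_power_sum N (h w : nat -> {poly rat}) (lam : seq nat) : (0 < N)%N ->
  h 0%N = 1 ->
  (forall k, h k.+1 *+ k.+1 = \sum_(j < k.+1) w j.+1 * h (k - j)%N) ->
  w N = 'X -> (forall k, k != N -> w k = 0) ->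
  all (fun k => 0 < k)%N lam ->
  (\prod_(k <- lam) (if (k <= N)%N then h k else 0))`_1 != 0 -> lam = [:: N].
Proof.
move=> N_gt0 h0 hS wN w0.
pose H k := if (k <= N)%N then h k else 0.
have h_lt k : (0 < k < N)%N -> h k = 0.
  case: k => // k kN; apply/eqP; have := hS k; rewrite big1 => [/eqP|j _]; last first.
    by rewrite w0 ?mul0r // neq_ltn (leq_ltn_trans _ kN) // ltnS -ltnS.
  by rewrite -scaler_nat scaler_eq0 pnatr_eq0.
have hN : h N = N%:R^-1 *: 'X.
  case: (N) N_gt0 (hS N.-1) wN w0 => // n _ /= hSn wn w0'.
  have : h n.+1 *+ n.+1 = 'X.
    rewrite hSn big_ord_recr /= subnn h0 mulr1 wn big1 ?add0r // => j _.
    by rewrite w0' ?mul0r // eqSS neq_ltn ltn_ord.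
  by move=> <-; rewrite -scaler_nat scalerA mulVf ?pnatr_eq0 // scale1r.
have HE k : (0 < k)%N -> H k = (k == N)%:R * N%:R^-1 *: 'X.
  move=> k_gt0; rewrite /H; case: ltngtP => kN.
  - by rewrite h_lt ?k_gt0 // mul0r scale0r.
  - by rewrite mul0r scale0r.
  by rewrite kN hN mul1r.
rewrite -/H; case: lam => [|k [|l lam]] /=; first by rewrite big_nil coef1 eqxx.
  rewrite andbT big_seq1 => k_gt0; rewrite -/(H k) HE //.
  by case: (k =P N) => [-> | _]; rewrite // mul0r scale0r coef0 eqxx.
case/and3P=> k_gt0 l_gt0 _; rewrite !big_cons -!/(H _) !HE //.
by rewrite -!scalerAl !coefZ coefXM /= coefZ coefXM /= !mulr0 eqxx.
Qed.

End NonnegCoefficients.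

(** Subtracting [b] from every entry leaves a sum equal to the number of entries [b.+1]. *)
Lemma two_sizes_perm (b : nat) (s : seq nat) :
  all (fun k => (k == b) || (k == b.+1)) s ->
  perm_eq s (nseq (sumn s - size s * b) b.+1 ++ nseq (size s - (sumn s - size s * b)) b).
Proof.
pose c := count (pred1 b.+1) s.
move=> s_b; have sumE : sumn s = size s * b + c.
  rewrite /c; elim: s s_b {c} => //= k s IHs /andP[kb /IHs ->].
  by case: (eqVneq k b.+1) kb => [-> _ | _]; [|rewrite orbF => /eqP ->] => /=; lia.
have -> : sumn s - size s * b = c by lia.
rewrite /c; elim: s s_b {c sumE} => //= k s IHs /andP[kb /IHs {}IHs].
case: (eqVneq k b.+1) kb => [-> _ | _]; first by rewrite add1n subSS perm_cons.
rewrite orbF => /eqP ->; rewrite add0n subSn ?count_size //.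
by rewrite -[b :: s]cat1s perm_sym -[nseq (_ - _).+1 _]cat1s perm_catCA perm_cons perm_sym.
Qed.

(** * Connected partitions from e-positivity *)

Section Wolfgang.
Variables (N : nat) (f : 'I_N -> 'I_N) (e : rel 'I_N).
Let D := [set v : 'I_N | 0 < v].
Hypothesis f_lt : forall v, v \in D -> f v < v.
Hypothesis eE : forall u v, e u v = (u \in D) && (v == f u) || (v \in D) && (u == f v).
Hypothesis N_gt0 : 0 < N.

Local Open Scope ring_scope.

Lemma e_positive_top_term (s : seq (seq nat * rat)) :
  all (fun p => is_int_partition p.1 && (0 <= p.2)) s ->
  chromatic_sym e = \sum_(p <- s) p.2 *: elem_sym #|{: 'I_N}| p.1 ->
  exists2 p, p \in s & (p.1 = [:: N]) /\ 0 < p.2.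
Proof.
(* Only components of size [N] survive, so the coefficient of ['X] isolates the term of [[:: N]]. *)
move=> s_ok X_e; pose w k : {poly rat} := if k == N then 'X else 0.
have [h [h0 hS]] := exists_complete_sequence w.
have := e_expansion_specialization N f D e f_lt eE N_gt0 s h w X_e h0 hS.
move/(congr1 (fun p : {poly rat} => p`_1)); rewrite !coef_sum => E.
have w_ge0 k : nneg_coefs (w k).
  by rewrite /w; case: ifP => _; [apply: nneg_coefsX | apply: nneg_coefs0].
have /hasP[p ps p1] : has (fun p => (p.2 *: \prod_(k <- p.1)
    (if (k <= N)%N then h k else 0))`_1 != 0) s.
  apply: contraTT isT => /hasPn s0; move: E; rewrite [RHS]big1_seq => [|p /andP[_ /s0]]; last first.
    by rewrite negbK => /eqP.
  (* The full edge set [D] has the root as its only component root, hence one component of size [N],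
     which contributes 1; the other edge sets contribute nonnegatively. *)
  rewrite (bigD1 D) //= (_ : ~: D = [set Ordinal N_gt0]); last first.
    by apply/setP => v; rewrite !inE -leqNgt leqn0.
  have := sum_branch N f D f_lt D (subxx _).
  rewrite (_ : ~: D = [set Ordinal N_gt0]); last first.
    by apply/setP => v; rewrite !inE -leqNgt leqn0.
  rewrite !big_set1 => ->; rewrite /w eqxx coefX /= => /eqP.
  rewrite paddr_eq0 ?oner_eq0 // sumr_ge0 // => S _.
  by apply: nneg_coefs_prod => r; apply: w_ge0.
exists p => //; have /allP/(_ _ ps) := s_ok; case/andP=> /andP[_ p_gt0] p_ge0.
move: p1; rewrite coefZ mulf_eq0 negb_or => /andP[p2 p1]; split; last by rewrite lt_def p2.
apply: (single_power_sum N h w) => //; first by rewrite /w eqxx.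
by move=> k /negbTE kN; rewrite /w kN.
Qed.

Lemma e_positive_two_sizes (b x y : nat) : e_positive e ->
  (0 < b)%N -> (x * b + y * b.+1)%N = N ->
  exists P, connected_partition e P && has_type P (nseq y b.+1 ++ nseq x b).
Proof.
case=> s [s_ok X_e] b_gt0 N_xy.
have [p0 p0s [p0N p0_gt0]] := e_positive_top_term s s_ok X_e.
(* Only forests whose components all have size [b] or [b.+1] survive, and the power of ['X] counts
   their components. *)
pose w k : {poly rat} := if (k == b) || (k == b.+1) then 'X else 0.
have [h [h0 hS]] := exists_complete_sequence w.
have := e_expansion_specialization N f D e f_lt eE N_gt0 s h w X_e h0 hS.
move/(congr1 (fun p : {poly rat} => p`_(x + y))); rewrite !coef_sum => E.
have w_ge0 k : nneg_coefs (w k).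
  by rewrite /w; case: ifP => _; [apply: nneg_coefsX | apply: nneg_coefs0].
have h_ge0 := nneg_coefs_complete h w h0 hS w_ge0.
have hN : 0 < (h N)`_(x + y).
  by rewrite -N_xy (complete_coef_two_sizes h w) // /w eqxx ?orbT.
(* On the e-side the term of [[:: N]] is positive because [h N] has a positive coefficient, and no
   other term is negative. *)
have : \sum_(S : {set 'I_N} | S \subset D)
    (\prod_(r in ~: S) w #|branch N f S r|)`_(x + y) != 0.
  rewrite E gt_eqF // (big_rem p0) //= coefZ p0N big_seq1 leqnn.
  rewrite ltr_wpDr ?mulr_gt0 // big_seq sumr_ge0 // => p /mem_rem ps.
  have /allP/(_ _ ps)/andP[_ p_ge0] := s_ok.
  rewrite coefZ mulr_ge0 //; apply: nneg_coefs_prod => k.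
  by case: ifP => _; [apply: h_ge0 | apply: nneg_coefs0].
case: (pickP (fun S : {set 'I_N} => (S \subset D) &&
    ((\prod_(r in ~: S) w #|branch N f S r|)`_(x + y) != 0))) => [S | no]; last first.
  rewrite big1 ?eqxx // => S SD; apply/eqP.
  by have := no S; rewrite SD /=; case: eqP.
case/andP=> SD wS _.
have sizes r : r \in ~: S -> (#|branch N f S r| == b) || (#|branch N f S r| == b.+1).
  move=> rS; apply: contraNT wS => /negbTE rb.
  by rewrite (bigD1 r) //= /w rb mul0r coef0.
have cardS : #|~: S| = (x + y)%N.
  apply/eqP; apply: contraNT wS => neq.
  under eq_bigr => r rS do rewrite /w sizes //.
  by rewrite prodr_const coefXn [(x + y)%N == _]eq_sym (negbTE neq).
exists [set branch N f S r | r in ~: S]; apply/andP; split.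
  rewrite /connected_partition (branch_partition N f D f_lt S SD) /=.
  apply/forall_inP => _ /imsetP[r _ ->]; apply: (branch_connected N f D f_lt) => //.
    by move=> u v; rewrite !eE orbC.
  by move=> v vD; rewrite eE vD eqxx.
rewrite /has_type; set P := [set _ | _ in _].
have cardP : #|P| = (x + y)%N by rewrite card_in_imset //; apply: branch_inj.
set l := [seq _ | _ in _].
have sizel : size l = (x + y)%N by rewrite /l size_map -cardE.
have suml : sumn l = N.
  rewrite /l sumnE big_map -[RHS](card_ord N) -cardsT.
  by rewrite (card_partition (branch_partition N f D f_lt S SD)) -big_enum.
have all_l : all (fun k => (k == b) || (k == b.+1)) l.
  apply/allP => k /mapP[B + ->]; rewrite mem_enum => /imsetP[r rS ->]; exact: sizes.
have := two_sizes_perm b l all_l; rewrite sizel suml.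
(* The number of parts and their sum fix the type. *)
have -> : (N - (x + y) * b)%N = y by lia.
by rewrite addnK.
Qed.

End Wolfgang.

(** * Spiders *)

Lemma card_ord_interval (N lo hi : nat) : lo <= hi -> hi < N ->
  #|[set v : 'I_N | lo < v <= hi]| = hi - lo.
Proof.
elim: hi => [|hi IHhi] le_lo lt_hi.
  by apply: eq_card0 => v; rewrite !inE; lia.
case: (leqP lo hi) => [lo_hi | ]; last first.
  by move=> hi_lo; rewrite (_ : lo = hi.+1) ?subnn; [apply: eq_card0 => v; rewrite !inE|]; lia.
rewrite subSn // -(IHhi lo_hi (ltnW lt_hi)) -add1n.
rewrite (_ : [set _ | _] = Ordinal lt_hi |: [set v : 'I_N | lo < v <= hi]).
  by rewrite cardsU1 inE /= ltnn andbF.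
by apply/setP => v; rewrite !inE -val_eqE /=; lia.
Qed.

Lemma sumn_takeS (lam : seq nat) j :
  sumn (take j.+1 lam) = sumn (take j lam) + nth 0 lam j.
Proof.
case: (ltnP j (size lam)) => [jl | lj]; first by rewrite (take_nth 0 jl) sumn_rcons.
by rewrite nth_default // !take_oversize ?addn0 // ltnW.
Qed.

Lemma sumn_take_le (lam : seq nat) j : sumn (take j lam) <= sumn lam.
Proof. by rewrite -{2}(cat_take_drop j lam) sumn_cat leq_addr. Qed.

Section Spider.
Variable lam : seq nat.
Local Notation vertex := (spider_vertex lam).
Implicit Types (u v : vertex) (B : {set vertex}).

Lemma leg_startP (v : nat) :
  reflect (exists2 j, j < size lam & v = (sumn (take j lam)).+1) (leg_start lam v).
Proof.
apply: (iffP hasP) => [[j j_lt /eqP->] | [j jl ->]]; exists j => //.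
  by rewrite mem_iota in j_lt.
by rewrite mem_iota.
Qed.

Definition leg j : {set vertex} :=
  [set v : vertex | sumn (take j lam) < v <= sumn (take j.+1 lam)].

Lemma card_leg j : #|leg j| = nth 0 lam j.
Proof.
rewrite card_ord_interval ?ltnS ?sumn_take_le //; rewrite sumn_takeS ?leq_addr //.
by rewrite addKn.
Qed.

Lemma card_legs_from j : #|[set v : vertex | sumn (take j lam) < v]| = sumn (drop j lam).
Proof.
have := card_ord_interval (sumn lam).+1 _ (sumn lam) (sumn_take_le lam j) (ltnSn _).
have -> : sumn lam - sumn (take j lam) = sumn (drop j lam).
  by rewrite -{1}(cat_take_drop j lam) sumn_cat addKn.
move=> <-.
by apply: eq_card => v; rewrite !inE -[v <= _]ltnS ltn_ord andbT.
Qed.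

Lemma legs_cover i v : sumn (take i lam) < v -> exists2 j, i <= j < size lam & v \in leg j.
Proof.
have: v <= sumn (take (size lam) lam) by rewrite take_size -ltnS.
elim: {1 3}(size lam) (leqnn (size lam)) => [|k IHk] kl v_le v_gt; first by rewrite take0 /= in v_le; lia.
case: (leqP v (sumn (take k lam))) => [v_k | v_k].
  have [j /andP[ij jk] vj] := IHk (ltnW kl) v_k v_gt.
  by exists j; rewrite ?ij.
exists k; last by rewrite inE v_k.
rewrite kl andbT leqNgt; apply/negP => ki; move: v_gt.
rewrite ltnNge (leq_trans v_le) //.
by rewrite -(take_takel lam ki) sumn_take_le.
Qed.

(** Away from the center, adjacent labels are consecutive, and the label that begins a leg is never
    joined to its predecessor unless that is the center. *)
Lemma leg_closed j u v : u \in leg j -> spider lam u v -> v != ord0 -> v \in leg j.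
Proof.
rewrite /leg !inE -val_eqE /spider /spider_adj /= => /andP[u_gt u_le] uv v0.
case/orP: uv => /orP[]; [lia | | lia | ].
  case/and3P=> _ /eqP vu /leg_startP v_start.
  (* If [u] were the last vertex of leg [j], its successor would begin leg [j.+1], or exceed all
     labels when [j] is the last leg. *)
  rewrite vu ltnW //= ltn_neqAle u_le andbT; apply/negP => /eqP u_last.
  apply: v_start; exists j.+1; last by rewrite vu u_last.
  rewrite ltnNge; apply/negP => le_j; have := ltn_ord v.
  by rewrite vu u_last take_oversize // ltnn.
case/and3P=> _ /eqP uv /leg_startP u_start; rewrite uv in u_gt u_le u_start.
rewrite (ltnW u_le) andbT ltn_neqAle -ltnS u_gt andbT.
apply/negP => /eqP v_first; apply: u_start; exists j; last by rewrite v_first.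
rewrite ltnNge; apply/negP => le_j.
move: u_gt u_le; rewrite !take_oversize ?(leq_trans le_j) //; lia.
Qed.

Lemma block_in_leg j B u : induced_connected (spider lam) B ->
  u \in B -> u \in leg j -> ord0 \notin B -> B \subset leg j.
Proof.
move=> /forall_inP conn uB uj B0; apply/subsetP => v vB.
have /forall_inP/(_ v vB)/connectP[p + ->] := conn u uB.
elim: p u uB uj => //= w p IHp u uB uj /andP[/and3P[uw _ wB] pth].
apply: (IHp w) => //; apply: leg_closed uj uw _.
by apply: contraNneq B0 => <-.
Qed.

(** The witness [k] is the number of blocks inside leg [p]. The second bound adds the at most [b.+1]
    vertices of the center's block to the at most [k * b.+1] vertices in those blocks. *)
Lemma connected_partition_center (p b : nat) (P : {set {set vertex}}) :
  sorted geq lam -> p.+1 < size lam -> nth 0 lam p.+1 < b ->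
  connected_partition (spider lam) P ->
  (forall B, B \in P -> b <= #|B| <= b.+1) ->
  exists2 k, k * b <= nth 0 lam p
    & (sumn (drop p.+1 lam)).+1 + nth 0 lam p <= k.+1 * b.+1.
Proof.
move=> lam_sorted pl small /andP[/and3P[/eqP covP trivP P0] /forall_inP conn] sizes.
have in_cov v : v \in cover P by rewrite covP inE.
pose B0 := pblock P ord0; have B0P : B0 \in P by apply: pblock_mem.
have center B : B \in P -> ord0 \in B -> B = B0.
  by move=> BP B0'; rewrite /B0 (def_pblock trivP BP).
(* A block missing the center would lie in one leg beyond [p], which by sortedness has fewer than
   [b] vertices. *)
have tail_B0 v : sumn (take p.+1 lam) < v -> v \in B0.
  move=> /legs_cover[j /andP[pj jl] vj].
  have vB : v \in pblock P v by rewrite mem_pblock.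
  have BP : pblock P v \in P by apply: pblock_mem.
  case: (boolP (ord0 \in pblock P v)) => [/(center _ BP) <- // | n0].
  have /subset_leq_card := block_in_leg _ _ _ (conn _ BP) vB vj n0.
  have /andP[le_b _] := sizes _ BP; rewrite card_leg.
  have : nth 0 lam j <= nth 0 lam p.+1.
    by apply: (sorted_leq_nth (leT := geq)) => // [x y z|x] /=; rewrite /geq /=; lia.
  lia.
pose P' := [set B in P | B \subset leg p].
have P'P : P' \subset P by apply/subsetP => B; rewrite inE => /andP[].
have trivP' := trivIsetS P'P trivP.
have sum_lo : #|P'| * b <= \sum_(B in P') #|B|.
  rewrite -sum_nat_const; apply: leq_sum => B /(subsetP P'P) /sizes; lia.
have sum_hi : \sum_(B in P') #|B| <= #|P'| * b.+1.
  rewrite -sum_nat_const; apply: leq_sum => B /(subsetP P'P) /sizes; lia.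
have cov_P' : cover P' \subset leg p.
  by apply/bigcupsP => B; rewrite inE => /andP[].
have leg_sub : leg p \subset (leg p :&: B0) :|: cover P'.
  apply/subsetP => v vp; rewrite in_setU in_setI vp /=.
  have vB : v \in pblock P v by rewrite mem_pblock.
  have BP : pblock P v \in P by apply: pblock_mem.
  case: (boolP (ord0 \in pblock P v)) => [/(center _ BP) <- | n0]; first by rewrite vB.
  apply/orP; right; apply/bigcupP; exists (pblock P v) => //.
  by rewrite inE BP (block_in_leg _ _ _ (conn _ BP) vB vp n0).
have B0_sub : [set ord0] :|: [set v : vertex | sumn (take p.+1 lam) < v] :|: (leg p :&: B0) \subset B0.
  rewrite !subUset sub1set mem_pblock in_cov subsetIr andbT /=.
  by apply/subsetP => v; rewrite inE => /tail_B0.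
exists #|P'|.
  by rewrite -(card_leg p) (leq_trans sum_lo) // (eqP trivP') subset_leq_card.
(* The center, leg [p] and the later legs occupy disjoint label ranges, so the sizes add. *)
move: (subset_leq_card B0_sub); rewrite cardsU [X in _ - X]eq_card0 => [|v]; last first.
  by rewrite !inE -val_eqE /=; lia.
rewrite subn0 cardsU1 inE ltn0 card_legs_from.
move=> B0_ge; have /andP[_ B0_le] := sizes _ B0P.
have leg_le : nth 0 lam p <= #|leg p :&: B0| + #|P'| * b.+1.
  rewrite -(card_leg p) (leq_trans (subset_leq_card leg_sub)) // cardsU.
  by rewrite (leq_trans (leq_subr _ _)) // leq_add2l -(eqP trivP').
rewrite mulSn (leq_trans (leq_add (leqnn _) leg_le)) // addnA leq_add2r.
exact: leq_trans B0_ge B0_le.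
Qed.

Definition spider_parent v : vertex := if leg_start lam v then ord0 else inord v.-1.

Lemma spider_parent_lt v : v \in [set v : vertex | 0 < v] -> spider_parent v < v.
Proof.
rewrite inE /spider_parent; case: ifP => // _ v_gt0.
by rewrite inordK ?prednK // ltnW // ltn_ord.
Qed.

Lemma spiderE : 0 < size lam ->
  forall u v, let D := [set v : vertex | 0 < v] in
  spider lam u v =
    (u \in D) && (v == spider_parent u) || (v \in D) && (u == spider_parent v).
Proof.
move=> lam_gt0 u v /=; rewrite !inE /spider orbC.
suff adjE x y : spider_adj lam (x : vertex) (y : vertex) = (0 < y) && (x == spider_parent y).
  by rewrite !adjE.
rewrite /spider_adj /spider_parent -val_eqE.
case: ifP => [/leg_startP[j _ yj] | /negbT/leg_startP y_start] /=.
  by rewrite yj /= andbT !andbF orbF.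
(* Label 1 begins the first leg; hence a nonzero [y] that begins no leg has a nonzero predecessor,
   as [spider_adj] demands. *)
have y1 : y != 1 :> nat.
  by apply/eqP => y1; apply: y_start; exists 0; rewrite ?take0.
rewrite andbF andbT /= inordK; last by have := ltn_ord y; lia.
lia.
Qed.
End Spider.

(* lam = [:: lam_1; ...; lam_d] (1-based in the paper): lam_i = nth 0 lam i.-1,
   lam_(i+1) = nth 0 lam i, t = lam_(i+1) + ... + lam_d = sumn (drop i lam). *)
Theorem theorem3p6 (lam : seq nat) (i m : nat) :
  sorted geq lam -> all (fun k => 0 < k) lam ->
  2 <= i -> i < size lam -> 0 < m ->
  let n := (sumn lam).+1 in
  let a := (nth 0 lam i.-1 + m) %/ m in      (* = ceil((lam_i + 1)/m) *)
  let q := n %/ a in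
  let r := n %% a in
  let d' := r %/ q in
  let r' := r %% q in
  let t := sumn (drop i lam) in
  2 * m - 1 < t ->
  nth 0 lam i < a ->
  ((m * (a - 1))%:R / (t.+1 - 2 * m)%:R < (q%:R : rat))%R ->
  ~ (exists P : {set {set spider_vertex lam}},
        connected_partition (spider lam) P &&
        has_type P (nseq r' (a + d').+1 ++ nseq (q - r') (a + d')))
  /\ ~ e_positive (spider lam).
Proof.
move=> lam_sorted lam_gt0 i_ge2 i_lt m_gt0 n a q r d' r' t t_gt a_gt q_gt.
have a_gt0 : 0 < a by apply: leq_ltn_trans a_gt.
have a_le_n : a <= n.
  rewrite /a (divnDr _ (dvdnn m)) divnn m_gt0 addn1 ltnS (leq_trans (leq_div _ _)) //.
  by rewrite (leq_trans _ (sumn_take_le lam i.-1.+1)) // sumn_takeS leq_addl.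
have q_gt0 : 0 < q by rewrite divn_gt0.
(* These are the two defining inequalities of the ceiling [a]. *)
have [lo hi] : m * (a - 1) <= nth 0 lam i.-1 /\ nth 0 lam i.-1 < m * a.
  have := divn_eq (nth 0 lam i.-1 + m) m; rewrite -/a.
  have := ltn_pmod (nth 0 lam i.-1 + m) m_gt0.
  by rewrite mulnBr muln1 mulnC; lia.
(* Since [q * d' <= r <= a - 1], the lower bound on [q] gives [q * (m * d') <= m * (a - 1) < q *
   (t.+1 - 2 * m)]. *)
have md'_lt : m * d' < t.+1 - 2 * m.
  have t_pos : (0 < (t.+1 - 2 * m)%:R :> rat)%R by rewrite ltr0n; lia.
  move: q_gt; rewrite ltr_pdivrMr // -natrM ltr_nat => q_gt.
  rewrite -(ltn_pmul2l q_gt0); apply: leq_ltn_trans q_gt.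
  rewrite mulnCA leq_mul2l mulnC (leq_trans (leq_trunc_div _ _)) ?orbT //.
  by have := ltn_pmod n a_gt0; rewrite -/r; lia.
have no_partition : ~ exists P : {set {set spider_vertex lam}},
    connected_partition (spider lam) P &&
    has_type P (nseq r' (a + d').+1 ++ nseq (q - r') (a + d')).
  case=> P /andP[P_conn /perm_mem P_type].
  case: (i) i_ge2 i_lt a_gt lo hi @t {t_gt} md'_lt {q_gt} => // p _ p_lt a_gt /= lo hi md'_lt.
  have [| B BP | k k_le] := connected_partition_center lam p (a + d') P lam_sorted p_lt _ P_conn.
  - by rewrite ltn_addr.
  - have : #|B| \in [seq #|C| | C : {set spider_vertex lam} in P] by apply: map_f; rewrite mem_enum.
    by rewrite P_type mem_cat !mem_nseq => /orP[] /andP[_ /eqP ->]; rewrite !leqnn ?leqnSn.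
  (* Indeed [k * (a + d') <= nth 0 lam p < m * a <= m * (a + d')]. *)
  have k_lt : k < m.
    rewrite -(ltn_pmul2r (_ : 0 < a + d')) ?ltn_addr //.
    by apply: leq_ltn_trans k_le (leq_trans hi _); rewrite leq_mul2l leq_addr orbT.
  (* The bound is at most [m * (a + d').+1], that is [m * (a - 1) + m * d' + 2 * m], which [lo] and
     [md'_lt] place strictly below the size of leg [p] plus [t.+1]. *)
  apply/negP; rewrite -ltnNge (leq_ltn_trans (leq_mul k_lt (leqnn _))) //.
  move: lo md'_lt; rewrite mulnBr muln1 -addnS mulnDr mulnS; lia.
split=> // e_pos; apply: no_partition.
have lam_size : 0 < size lam by apply: leq_ltn_trans i_lt.
apply: (e_positive_two_sizes n (spider_parent lam) (spider lam)
  (spider_parent_lt lam) (spiderE lam lam_size) _ (a + d') (q - r') r') => //.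
  by rewrite addn_gt0 a_gt0.
(* The parts sum to [q * (a + d') + r'], which is [q * a + r], hence [n]. *)
have := divn_eq n a; have := divn_eq r q; have := ltn_pmod r q_gt0.
rewrite -/q -/r -/d' -/r' => r'_lt rE nE.
rewrite mulnS addnCA -mulnDl subnK; last exact: ltnW.
by rewrite [RHS]nE mulnDr rE; lia.
Qed.
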